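(* The frame-convex hull of any two $2$-flats in general position in either $\mathbb{R}^4$ or $\mathbb{R}^5$ consists solely of the original $2$-flats.
   Context: A box in $\mathbb{R}^d$ is a product of $d$ (closed, bounded, possibly degenerate) intervals, one in each coordinate direction. A $2$-flat is a $2$-dimensional affine subspace. The frame-convex hull of a set of $2$-flats in $\mathbb{R}^d$ is the set of all $2$-flats that meet every box meeting each of the given $2$-flats. ''General position'' is meant in the usual algebraic sense: the pair of $2$-flats lies outside some proper algebraic subset of the space of pairs of $2$-flats. *)

(* Defs.v *)
From HB Require Import structures.
From mathcomp Require Import all_boot all_order all_algebra.
From mathcomp Require Import classical_sets reals.
From mathcomp Require Import mpoly.

Set Implicit Arguments.
Unset Strict Implicit.
Unset Printing Implicit Defensive.

Import Order.TTheory GRing.Theory Num.Theory.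

Local Open Scope classical_set_scope.
Local Open Scope ring_scope.

Definition boxes (R : realType) (d : nat) : set (set 'rV[R]_d) :=
  [set B | exists a b : 'rV[R]_d, (forall i, a 0 i <= b 0 i) /\
           B = [set x : 'rV[R]_d | forall i, a 0 i <= x 0 i <= b 0 i]].

Arguments boxes : clear implicits.

Definition flat (R : realType) (k d : nat) (p : 'rV[R]_d) (U : 'M[R]_(k, d)) :
    set 'rV[R]_d :=
  [set x | (x - p <= U)%MS].

Definition flats (R : realType) (k d : nat) : set (set 'rV[R]_d) :=
  [set F | exists p (U : 'M[R]_(k, d)), row_free U /\ F = flat p U].

Arguments flats : clear implicits.

Definition frame_hull (R : realType) (k d : nat) (FF : set (set 'rV[R]_d)) :
    set (set 'rV[R]_d) :=
  [set G | flats R k d G /\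
     forall B, boxes R d B ->
       (forall F, FF F -> F `&` B !=set0) -> G `&` B !=set0].

Definition pair_coords (R : realType) (k d : nat) (p : 'rV[R]_d)
    (U : 'M[R]_(k, d)) (q : 'rV[R]_d) (V : 'M[R]_(k, d)) :
    'rV[R]_((d + k * d) + (d + k * d)) :=
  row_mx (row_mx p (mxvec U)) (row_mx q (mxvec V)).

(* The pairs of k-flats form the quotient of the Zariski-open set of tuples
   (p, U, q, V) with U and V of full rank by the changes of base points and
   bases.  This quotient map has local sections that are regular on Zariski-open
   sets covering the space of pairs, so a set of pairs is Zariski closed exactly
   when its preimage is the zero set, among these tuples, of polynomials in
   their entries.  Since Z is a set of pairs of flats, that zero set does not
   depend on the tuples chosen to represent the flats. *)
Definition algebraic_pairs (R : realType) (k d : nat)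
    (Z : set (set 'rV[R]_d * set 'rV[R]_d)) : Prop :=
  Z `<=` flats R k d `*` flats R k d /\
  exists P : set {mpoly R[(d + k * d) + (d + k * d)]},
    forall p (U : 'M[R]_(k, d)) q (V : 'M[R]_(k, d)),
      row_free U -> row_free V ->
      (Z (flat p U, flat q V) <->
       forall f, P f -> f.@[pair_coords p U q V 0] = 0).

(* Main.v *)
Require Import Defs.
From HB Require Import structures.
From mathcomp Require Import all_boot all_order all_algebra.
From mathcomp Require Import classical_sets reals.
From mathcomp Require Import mpoly ring lra.

Set Implicit Arguments.
Unset Strict Implicit.
Unset Printing Implicit Defensive.

Import Order.TTheory GRing.Theory Num.Theory.

Local Open Scope classical_set_scope.
Local Open Scope ring_scope.

(* Write generic 2-flats F1, F2 as graphs, over the coordinates (x_a, x_b), of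
   affine maps f1, f2.  A flat G in the hull meets the box spanned by any x in F1
   and y in F2, hence has a point agreeing with x in every coordinate in which x
   and y agree.  Taking x and y over the same (x_a, x_b) shows that G is the graph
   of an affine map g, and that g_k = f1_k wherever f1_k = f2_k; hence
   g_k = f1_k + t_k (f2_k - f1_k) for a scalar t_k.
   For two further coordinates c, l, now take x and y with x_c = y_c, x_l = y_l
   and with (x_a, x_b), (y_a, y_b) differing by a unit vector e_i.  This gives
   scalars tau_i with tau_i * (slope_i g_k) = t_k * (slope_i f2_k) for k = c, l.
   These equations force t_c = t_l = 0 or t_c = t_l = 1, so G is F1 or F2.
   The argument works in every dimension d >= 4. *)

(** * Scalar lemmas: proportional affine forms and the equations for the [t k] *)

(** The zero set of [u] is a line, and vanishing at two of its points already makes [v] a multiple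
    of [u]. *)
Lemma pencil (R : realFieldType) (u1 u2 u0 v1 v2 v0 : R) :
  (u1 != 0) || (u2 != 0) ->
  (forall x y, u1 * x + u2 * y + u0 = 0 -> v1 * x + v2 * y + v0 = 0) ->
  exists t, [/\ v1 = t * u1, v2 = t * u2 & v0 = t * u0].
Proof.
move=> u_neq0 uv.
have n0 : u1 ^+ 2 + u2 ^+ 2 != 0.
  by rewrite paddr_eq0 ?sqr_ge0 // !sqrf_eq0 negb_and.
set N := u1 ^+ 2 + u2 ^+ 2 in n0.
(* The foot of the perpendicular from the origin to the line; the next point is its translate by the
   direction [(-u2, u1)]. *)
have h1 : v1 * (- u0 * u1 / N) + v2 * (- u0 * u2 / N) + v0 = 0.
  by apply: uv; rewrite /N; field.
have h2 : v1 * (- u0 * u1 / N - u2) + v2 * (- u0 * u2 / N + u1) + v0 = 0.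
  by apply: uv; rewrite /N; field.
have e : v2 * u1 = v1 * u2 by lra.
exists ((v1 * u1 + v2 * u2) / N); split.
- by apply: (mulIf n0); rewrite mulrAC divfK // /N; ring: e.
- by apply: (mulIf n0); rewrite mulrAC divfK // /N; ring: e.
- have -> : v0 = - (v1 * (- u0 * u1 / N) + v2 * (- u0 * u2 / N)) by lra.
  by rewrite /N; field.
Qed.

(** Each equation reads [(1 - tau i) * t k * Y i k = tau i * (1 - t k) * X i k]. So [t k] is 0 (or
    1) exactly when [tau i] is, which links [c] to [l]. Otherwise, eliminating [t k] between the two
    values of [i] makes the ratio of [X false k * Y true k] to [X true k * Y false k] the same at
    [c] and [l], against the second hypothesis. *)
Lemma pencil_ratio (F : realFieldType) (K : eqType) (X Y : bool -> K -> F)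
    (t : K -> F) (tau : bool -> F) (c l : K) :
  {in [:: c; l], forall k i, X i k != 0 /\ Y i k != 0} ->
  X false c * Y true c * (X true l * Y false l) !=
  X true c * Y false c * (X false l * Y true l) ->
  {in [:: c; l], forall k i,
     tau i * (X i k + t k * (Y i k - X i k)) = t k * Y i k} ->
  t l = t c /\ (t c = 0 \/ t c = 1).
Proof.
move=> XY0 fr h.
have {}h : {in [:: c; l], forall k i,
    (1 - tau i) * t k * Y i k = tau i * (1 - t k) * X i k}.
  by move=> k kin i; have := h k kin i; lra.
have t0 : {in [:: c; l] &, forall k k', t k = 0 -> t k' = 0}.
  move=> k k' kin k'in tk; have [X0 _] := XY0 k kin true.
  have [_ Y0] := XY0 k' k'in true.
  have := h k kin true; rewrite tk mulr0 mul0r subr0 mulr1 => /esym/eqP.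
  rewrite mulf_eq0 (negPf X0) orbF => /eqP tau0.
  have := h k' k'in true; rewrite tau0 !mul0r subr0 mul1r => /eqP.
  by rewrite mulf_eq0 (negPf Y0) orbF => /eqP.
have t1 : {in [:: c; l] &, forall k k', t k = 1 -> t k' = 1}.
  move=> k k' kin k'in tk; have [_ Y0] := XY0 k kin true.
  have [X0 _] := XY0 k' k'in true.
  have := h k kin true; rewrite tk subrr mulr0 mul0r mulr1 => /eqP.
  rewrite mulf_eq0 (negPf Y0) orbF => /eqP tau1.
  have := h k' k'in true; rewrite tau1 !mul0r => /esym/eqP.
  have -> : tau true = 1 by lra.
  by rewrite mul1r mulf_eq0 (negPf X0) orbF subr_eq0 => /eqP.
have cin : c \in [:: c; l] by rewrite inE eqxx.
have lin : l \in [:: c; l] by rewrite !inE eqxx orbT.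
have [tc0|tc0] := eqVneq (t c) 0.
  by split; [rewrite tc0 (t0 c)|left].
have [tc1|tc1] := eqVneq (t c) 1.
  by split; [rewrite tc1 (t1 c)|right].
have tl0 : t l != 0 by apply: contra_neq tc0 => /(t0 _ c); apply.
have tl1 : t l != 1 by apply: contra_neq tc1 => /(t1 _ c); apply.
have cross k : k \in [:: c; l] -> t k != 0 -> t k != 1 ->
    (1 - tau false) * tau true * (Y false k * X true k) =
    tau false * (1 - tau true) * (X false k * Y true k).
  move=> kin tk0 tk1; have tk : t k * (1 - t k) != 0.
    by rewrite mulf_neq0 // subr_eq0 eq_sym.
  apply: (mulfI tk).
  have := congr2 *%R (h k kin false) (esym (h k kin true)).
  by move=> e; lra.
have tau0 i : tau i != 0.
  apply/eqP => taui; have := h c cin i; rewrite taui subr0 mul1r !mul0r.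
  by apply/eqP; rewrite mulf_neq0 //; case: (XY0 c cin i).
have tau1 i : 1 - tau i != 0.
  apply/eqP => taui; have := h c cin i; rewrite taui !mul0r => /esym.
  apply/eqP; rewrite !mulf_neq0 // ?(proj1 (XY0 c cin i)) //.
  by rewrite subr_eq0 eq_sym.
case/eqP: fr.
have A0 : (1 - tau false) * tau true * (tau false * (1 - tau true)) != 0.
  by rewrite !mulf_neq0.
apply: (mulfI A0).
have := congr2 *%R (esym (cross c cin tc0 tc1)) (cross l lin tl0 tl1).
by move=> e; lra.
Qed.

(** * Flats as graphs over two coordinates *)

(** The equations at [k = a] and [k = b] are void once the slopes there are those of the identity
    and the offsets vanish, as in [graph_point]. *)
Definition graph (R : realType) (d : nat) (a b : 'I_d) (s : bool -> 'I_d -> R)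
    (o : 'I_d -> R) : set 'rV[R]_d :=
  [set x | forall k, x 0 k = s false k * x 0 a + s true k * x 0 b + o k].

Lemma graph_point (R : realType) (d : nat) (a b : 'I_d) s (o : 'I_d -> R) z w :
  [/\ s false a = 1, s true a = 0 & o a = 0] ->
  [/\ s false b = 0, s true b = 1 & o b = 0] ->
  exists x : 'rV_d, [/\ graph a b s o x, x 0 a = z & x 0 b = w].
Proof.
move=> [sfa sta oa] [sfb stb ob].
exists (\row_k (s false k * z + s true k * w + o k)).
have ea : s false a * z + s true a * w + o a = z by rewrite sfa sta oa; ring.
have eb : s false b * z + s true b * w + o b = w by rewrite sfb stb ob; ring.
by split=> [k||]; rewrite !mxE ?ea ?eb.
Qed.

Definition plucker (S : comNzRingType) (d : nat) (U : 'M[S]_(2, d)) k l : S :=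
  U 0 k * U 1 l - U 0 l * U 1 k.

(* The slopes of a flat over (x_a, x_b), cleared of the denominator
   [plucker U a b]; [false] and [true] stand for the directions of x_a and x_b. *)
Definition pslope (S : comNzRingType) (d : nat) (a b : 'I_d) (U : 'M[S]_(2, d))
    (i : bool) k : S :=
  if i then plucker U a k else plucker U k b.

Definition slope (R : fieldType) (d : nat) (a b : 'I_d) (U : 'M[R]_(2, d))
    (i : bool) k : R := pslope a b U i k / plucker U a b.

Lemma mulmx2E (S : comNzRingType) m d (z : 'M[S]_(m, 2)) (U : 'M[S]_(2, d)) i k :
  (z *m U) i k = z i 0 * U 0 k + z i 1 * U 1 k.
Proof.
rewrite mxE !big_ord_recl big_ord0 addr0; congr (_ + z i _ * U _ k).
  exact: val_inj.
exact: val_inj.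
Qed.

(** [plucker A 0 1] is the determinant of [A]: a change of basis rescales all Plücker coordinates by
    one factor. *)
Lemma pluckerM (S : comNzRingType) d (A : 'M[S]_2) (U : 'M[S]_(2, d)) k l :
  plucker (A *m U) k l = plucker A 0 1 * plucker U k l.
Proof. by rewrite /plucker !mulmx2E; ring. Qed.

Lemma slope_pivot (R : fieldType) (d : nat) (a b : 'I_d) (U : 'M[R]_(2, d)) :
  plucker U a b != 0 ->
  [/\ slope a b U false a = 1, slope a b U true a = 0,
      slope a b U false b = 0 & slope a b U true b = 1].
Proof.
move=> U0; rewrite /slope /pslope !divff //.
have p0 k : plucker U k k = 0 by rewrite /plucker subrr.
by rewrite !p0 !mul0r.
Qed.

Lemma flat_graph (R : realType) (d : nat) (a b : 'I_d) p (U : 'M[R]_(2, d)) :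
  plucker U a b != 0 ->
  exists o, [/\ o a = 0, o b = 0 & flat p U = graph a b (slope a b U) o].
Proof.
move=> U0; have [sfa sta sfb stb] := slope_pivot U0.
exists (fun k => p 0 k - slope a b U false k * p 0 a - slope a b U true k * p 0 b).
rewrite sfa sta sfb stb; split; [ring|ring|].
apply/seteqP; split=> x /=.
  move=> /submxP[z xp] k.
  have e j : x 0 j = p 0 j + z 0 0 * U 0 j + z 0 1 * U 1 j.
    by have := congr1 (fun M : 'rV_d => M 0 j) xp; rewrite mulmx2E !mxE => e; lra.
  by rewrite !e /slope /pslope; move: U0; rewrite /plucker => U0; field.
move=> gx; apply/submxP.
(* Cramer's rule in the columns [a] and [b] gives the coefficients of [x - p] on the rows of [U]. *)
pose zv := ((x 0 a - p 0 a) * U 1 b - (x 0 b - p 0 b) * U 1 a) / plucker U a b.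
pose wv := ((x 0 b - p 0 b) * U 0 a - (x 0 a - p 0 a) * U 0 b) / plucker U a b.
exists (\row_(i < 2) if i == 0 then zv else wv).
apply/rowP => k; rewrite mulmx2E !mxE /= gx /zv /wv /slope /pslope.
by move: U0; rewrite /plucker => U0; field.
Qed.

(** Differences of points over [(0, 0)], [(1, 0)] and [(0, 1)] write the identity as a coefficient
    matrix times the minor of [U] in columns [a], [b]; take determinants. *)
Lemma flat_onto (R : realType) (d : nat) (a b : 'I_d) p (U : 'M[R]_(2, d)) :
  (forall z w, exists x, [/\ flat p U x, x 0 a = z & x 0 b = w]) ->
  plucker U a b != 0.
Proof.
move=> onto.
have [x0 [/submxP[z0 e0] a0 b0]] := onto 0 0.
have [x1 [/submxP[z1 e1] a1 b1]] := onto 1 0.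
have [x2 [/submxP[z2 e2] a2 b2]] := onto 0 1.
have e1' : x1 - x0 = (z1 - z0) *m U by rewrite mulmxBl -e0 -e1 opprB subrKA.
have e2' : x2 - x0 = (z2 - z0) *m U by rewrite mulmxBl -e0 -e2 opprB subrKA.
have h (M N : 'rV[R]_d) : M = N -> forall k, M 0 k = N 0 k by move=> ->.
have := h _ _ e1' a; have := h _ _ e1' b; have := h _ _ e2' a; have := h _ _ e2' b.
rewrite !mulmx2E !mxE a0 a1 a2 b0 b1 b2.
set r := z1 0 0 - z0 0 0; set s := z1 0 1 - z0 0 1.
set r' := z2 0 0 - z0 0 0; set s' := z2 0 1 - z0 0 1.
move=> h1 h2 h3 h4; apply/eqP; rewrite /plucker => p0.
have : (r * s' - r' * s) * (U 0 a * U 1 b - U 0 b * U 1 a) = 1 :> R.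
  have := congr2 *%R h1 h4; have := congr2 *%R h2 h3; lra.
by rewrite p0 mulr0 => /eqP; rewrite eq_sym oner_eq0.
Qed.

(** * Consequences of the hull condition for graphs *)

(** The box with opposite corners [x] and [y] is degenerate in every coordinate where they agree. *)
Lemma frame_hull_meets (R : realType) (k d : nat) (F1 F2 G : set 'rV[R]_d) x y :
  frame_hull k [set F1; F2] G -> F1 x -> F2 y ->
  exists2 w, G w & forall i, x 0 i = y 0 i -> w 0 i = x 0 i.
Proof.
move=> [_ hG] F1x F2y.
pose B := [set w : 'rV[R]_d | forall i,
  (\row_j Num.min (x 0 j) (y 0 j)) 0 i <= w 0 i <=
  (\row_j Num.max (x 0 j) (y 0 j)) 0 i].
have [||w [Gw Bw]] := hG B.
- by do 2 eexists; split; last reflexivity; move=> i; rewrite !mxE ge_min !le_max !lexx.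
- move=> F [] ->; [exists x|exists y]; split=> // i;
    by rewrite !mxE ge_min le_max !lexx ?orbT.
exists w => // i xy; have := Bw i; rewrite !mxE -xy minxx maxxx => wx.
by apply/eqP; rewrite eq_le andbC.
Qed.

Section GraphHull.
Variables (R : realType) (d : nat) (a b : 'I_d).
Variables (sX sY sG : bool -> 'I_d -> R) (oX oY oG : 'I_d -> R).
Hypothesis pX : [/\ sX false a = 1, sX true a = 0, sX false b = 0 & sX true b = 1].
Hypothesis pY : [/\ sY false a = 1, sY true a = 0, sY false b = 0 & sY true b = 1].
Hypothesis oX0 : oX a = 0 /\ oX b = 0.
Hypothesis oY0 : oY a = 0 /\ oY b = 0.
Hypothesis hG : forall x y : 'rV[R]_d, graph a b sX oX x -> graph a b sY oY y ->
  exists2 w : 'rV[R]_d, graph a b sG oG w & forall i, x 0 i = y 0 i -> w 0 i = x 0 i.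

Let ptX z w : exists x : 'rV_d, [/\ graph a b sX oX x, x 0 a = z & x 0 b = w].
Proof. by case: pX oX0 => ? ? ? ? [? ?]; apply: graph_point. Qed.

Let ptY z w : exists x : 'rV_d, [/\ graph a b sY oY x, x 0 a = z & x 0 b = w].
Proof. by case: pY oY0 => ? ? ? ? [? ?]; apply: graph_point. Qed.

(** Over a base point where the two affine maps have equal [k]-th coordinates, [x] and [y] agree at
    [a], [b] and [k], so the third map takes the same value there. Then [pencil] applies to the
    differences with the first map. *)
Lemma graph_hull_pencil k :
  (sY false k - sX false k != 0) || (sY true k - sX true k != 0) ->
  exists t, (forall i, sG i k = sX i k + t * (sY i k - sX i k)) /\
            oG k = oX k + t * (oY k - oX k).
Proof.
move=> u0; have [] := pencil (u0 := oY k - oX k) (v1 := sG false k - sX false k)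
   (v2 := sG true k - sX true k) (v0 := oG k - oX k) u0.
  move=> z w uzw.
  have [x [gx xa xb]] := ptX z w; have [y [gy ya yb]] := ptY z w.
  have [v gv vx] := hG gx gy.
  have va : v 0 a = z by rewrite vx xa.
  have vb : v 0 b = w by rewrite vx xb.
  have ek : x 0 k = y 0 k by rewrite gx gy xa xb ya yb; lra.
  by have := vx k ek; rewrite gv gx va vb xa xb; lra.
move=> t [e1 e2 e0]; exists t; split; last by lra.
by case; lra.
Qed.

(** Here [y] lies over the base point of [x] shifted by a unit in direction [i], and [tau] is the
    shift, in the same direction, of the base point of the hull's point [v]. *)
Lemma graph_hull_shift k l t i :
  (sY false k - sX false k) * (sY true l - sX true l) -
  (sY true k - sX true k) * (sY false l - sX false l) != 0 ->
  {in [:: k; l], forall j,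
    (forall i, sG i j = sX i j + t j * (sY i j - sX i j)) /\
    oG j = oX j + t j * (oY j - oX j)} ->
  exists tau, {in [:: k; l], forall j,
    tau * (sX i j + t j * (sY i j - sX i j)) = t j * sY i j}.
Proof.
set m := (X in X != 0) => m0 ht.
pose rk := - sY i k - (oY k - oX k); pose rl := - sY i l - (oY l - oX l).
(* Cramer's rule, with determinant [m], for the base point [(z, w)] at which [x] and the shifted [y]
   agree in coordinates [k] and [l]. *)
pose z := (rk * (sY true l - sX true l) - rl * (sY true k - sX true k)) / m.
pose w := (rl * (sY false k - sX false k) - rk * (sY false l - sX false l)) / m.
have [x [gx xa xb]] := ptX z w.
have [y [gy ya yb]] := ptY (z + (~~ i)%:R) (w + i%:R).
have eqs j : j \in [:: k; l] ->
  (sY false j - sX false j) * z + (sY true j - sX true j) * w =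
  - sY i j - (oY j - oX j).
  rewrite !inE => /orP[]/eqP->; rewrite /z /w /rk /rl; move: m0; rewrite /m => m0.
    by field.
  by field.
have exy j : j \in [:: k; l] -> x 0 j = y 0 j.
  move=> /eqs e; rewrite gx gy xa xb ya yb.
  by case: (i) e => /= e; lra.
have [v gv vx] := hG gx gy.
have kin : k \in [:: k; l] by rewrite inE eqxx.
have lin : l \in [:: k; l] by rewrite !inE eqxx orbT.
have fin tau : v 0 a = z + (~~ i)%:R * tau -> v 0 b = w + i%:R * tau ->
    {in [:: k; l], forall j, tau * (sX i j + t j * (sY i j - sX i j)) = t j * sY i j}.
  move=> va vb j jin; have := vx j (exy j jin).
  rewrite gv gx va vb xa xb; have [-> ->] := ht j jin; rewrite !(proj1 (ht j jin)).
  have := congr1 (fun r => t j * r) (eqs j jin).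
  by case: (i) => /=; lra.
(* In the base direction other than [i], [x] and [y] agree, so [v] has the same coordinate. *)
case: (i) fin xa xb ya yb => /= fin xa xb ya yb.
- exists (v 0 b - w); apply: fin; last by ring.
  by rewrite vx ?xa ?ya /=; ring.
- exists (v 0 a - z); apply: fin; first by ring.
  by rewrite vx ?xb ?yb /=; ring.
Qed.

End GraphHull.

(** * The polynomial expressing general position *)

(** The factors are the pivots, the slopes at [c] and [l], the determinant of [graph_hull_shift] and
    the inequality of [pencil_ratio], all cleared of denominators. *)
Definition pair_poly (S : comNzRingType) (d : nat) (a b c l : 'I_d)
    (U V : 'M[S]_(2, d)) : S :=
  let x := pslope a b U in let y := pslope a b V in
  let D i k := plucker U a b * y i k - plucker V a b * x i k in
  plucker U a b * plucker V a b *
  (x false c * x true c * x false l * x true l) *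
  (y false c * y true c * y false l * y true l) *
  (D false c * D true l - D true c * D false l) *
  (x false c * y true c * (x true l * y false l) -
   x true c * y false c * (x false l * y true l)).

(** With [c] fixed, it is enough to compare each remaining coordinate [l] with [c]. *)
Definition general_poly (S : comNzRingType) (d : nat) (a b c : 'I_d)
    (U V : 'M[S]_(2, d)) : S :=
  \prod_(l | l \notin [:: a; b; c]) pair_poly a b c l U V.

Lemma pair_poly_neq0 (R : fieldType) (d : nat) (a b c l : 'I_d)
    (U V : 'M[R]_(2, d)) :
  let x := slope a b U in let y := slope a b V in
  pair_poly a b c l U V != 0 ->
  [/\ plucker U a b != 0, plucker V a b != 0,
      {in [:: c; l], forall k i, x i k != 0 /\ y i k != 0},
      (y false c - x false c) * (y true l - x true l) -
      (y true c - x true c) * (y false l - x false l) != 0 &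
      x false c * y true c * (x true l * y false l) !=
      x true c * y false c * (x false l * y true l)].
Proof.
rewrite /= /pair_poly /slope !mulf_eq0 !negb_or -!andbA.
move=> /and5P[u0 v0 x1 x2] /and5P[x3 x4 y1 y2] /and4P[y3 y4 m0 f0]; split=> //.
- move=> k; rewrite !inE => /orP[]/eqP-> [];
    by rewrite !mulf_neq0 ?invr_eq0.
- apply: contra_neq m0 => m0.
  (* Clearing denominators multiplied this expression by the square of the product of the pivots. *)
  transitivity ((plucker U a b * plucker V a b) ^+ 2 * 0); last by rewrite mulr0.
  by rewrite -m0; field; rewrite u0 v0.
- apply: contra_neq f0 => f0.
  move/eqP: f0; rewrite -subr_eq0 => /eqP f0.
  transitivity ((plucker U a b * plucker V a b) ^+ 2 * 0); last by rewrite mulr0.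
  by rewrite -f0; field; rewrite u0 v0.
Qed.

(** * The hull of a general pair *)

Lemma frame_hull_general (R : realType) (d : nat) (a b c l : 'I_d)
    p (U : 'M[R]_(2, d)) q (V : 'M[R]_(2, d)) G :
  l \notin [:: a; b; c] -> general_poly a b c U V != 0 ->
  frame_hull 2 [set flat p U; flat q V] G -> G = flat p U \/ G = flat q V.
Proof.
move=> lP gUV hG.
have gen k : k \notin [:: a; b; c] -> pair_poly a b c k U V != 0.
  by move=> kP; move/prodf_neq0: gUV; apply.
have [U0 V0 _ _ _] := pair_poly_neq0 (gen l lP).
have pX := slope_pivot U0; have pY := slope_pivot V0.
have [oX [oXa oXb eX]] := flat_graph p U0.
have [oY [oYa oYb eY]] := flat_graph q V0.
have [[r [W [_ eG]]] _] := hG.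
(* Points of the two flats over the same [(z, w)] force a point of [G] over it, so [G] is a graph
   too. *)
have W0 : plucker W a b != 0.
  apply: (@flat_onto _ _ a b r) => z w.
  have [? ? ? ?] := pX; have [? ? ? ?] := pY.
  have [||x [gx xa xb]] := @graph_point _ _ a b (slope a b U) oX z w; first by [].
    by [].
  have [||y [gy ya yb]] := @graph_point _ _ a b (slope a b V) oY z w; first by [].
    by [].
  rewrite -eX in gx; rewrite -eY in gy.
  have [v Gv vx] := frame_hull_meets hG gx gy.
  by exists v; rewrite -eG !vx ?xa ?xb.
have [oG [oGa oGb eG']] := flat_graph r W0.
have pG := slope_pivot W0.
rewrite eX eY; rewrite eG eX eY eG' in hG *.
have {}hG x y := @frame_hull_meets _ _ _ _ _ _ x y hG.
set sX := slope a b U in pX hG *; set sY := slope a b V in pY hG *.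
set sG := slope a b W in pG hG *.
(* The condition on [k] stands under the quantifier so that choice yields a total [t]; its value at
   [a] and [b] is arbitrary. *)
have ex k : exists t, k \notin [:: a; b] ->
    (forall i, sG i k = sX i k + t * (sY i k - sX i k)) /\
    oG k = oX k + t * (oY k - oX k).
  case kP: (k \in [:: a; b]); first by exists 0.
  (* Equal slopes at [k] would kill the determinant for [c] and [k], or for [c] and [l] if
     [k = c]. *)
  suff u0 : (sY false k - sX false k != 0) || (sY true k - sX true k != 0).
    have [t tP] :=
      graph_hull_pencil pX pY (conj oXa oXb) (conj oYa oYb) hG u0.
    by exists t.
  have [kc|kc] := eqVneq k c; last first.
    have /gen/pair_poly_neq0[_ _ _ + _] : k \notin [:: a; b; c].
      by move: kP; rewrite !inE (negPf kc) orbF => ->.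
    apply: contraNT; rewrite negb_or !negbK -/sX -/sY => /andP[/eqP-> /eqP->].
    by rewrite !mulr0 subrr.
  have [_ _ _ + _] := pair_poly_neq0 (gen l lP).
  rewrite kc; apply: contraNT; rewrite negb_or !negbK -/sX -/sY => /andP[/eqP-> /eqP->].
  by rewrite !mul0r subrr.
have [t ht] := boolp.choice ex.
(* At [a] and [b] one slope of the first flat is 0, whereas its slopes at [c] are nonzero. *)
have [cab|cab] := boolP (c \in [:: a; b]).
  have [_ _ /(_ c) + _ _] := pair_poly_neq0 (gen l lP).
  rewrite inE eqxx => /(_ isT) h; have [_ sta sfb _] := pX.
  move: cab; rewrite !inE => /orP[]/eqP ec.
    by have [] := h true; rewrite -/sX ec sta eqxx.
  by have [] := h false; rewrite -/sX ec sfb eqxx.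
have key k : k \notin [:: a; b; c] -> t k = t c /\ (t c = 0 \/ t c = 1).
  move=> kP; have [_ _ nz m0 fr] := pair_poly_neq0 (gen k kP).
  have kab : k \notin [:: a; b].
    by apply: contra kP; rewrite !inE => /orP[]->; rewrite ?orbT.
  have htk : {in [:: c; k], forall j,
    (forall i, sG i j = sX i j + t j * (sY i j - sX i j)) /\
    oG j = oX j + t j * (oY j - oX j)}.
    by move=> j; rewrite !inE => /orP[]/eqP->; apply: ht.
  have sh i := graph_hull_shift pX pY (conj oXa oXb) (conj oYa oYb) hG i m0 htk.
  have [tau htau] := boolp.choice sh.
  by apply: pencil_ratio nz fr _ => j jin i; apply: htau.
have tc01 := (key l lP).2.
have tk k : k \notin [:: a; b] -> t k = t c.
  move=> kab; have [->//|kc] := eqVneq k c; apply: (key k _).1.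
  by move: kab; rewrite !inE (negPf kc) orbF.
have same sZ oZ : [/\ sZ false a = 1, sZ true a = 0, sZ false b = 0 & sZ true b = 1] ->
   oZ a = 0 /\ oZ b = 0 ->
   (forall k, k \notin [:: a; b] -> (forall i, sG i k = sZ i k) /\ oG k = oZ k) ->
   graph a b sG oG = graph a b sZ oZ.
  move=> [Zfa Zta Zfb Ztb] [oZa oZb] eZ; have [Gfa Gta Gfb Gtb] := pG.
  have {}eZ k : [/\ sG false k = sZ false k, sG true k = sZ true k & oG k = oZ k].
    have [|/eZ[es eo]] := boolP (k \in [:: a; b]); last by rewrite !es eo.
    by rewrite !inE => /orP[]/eqP->;
      rewrite ?(Zfa, Zta, oZa, Gfa, Gta, oGa) ?(Zfb, Ztb, oZb, Gfb, Gtb, oGb).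
  by apply/seteqP; split=> x gx k; have [e1 e2 e3] := eZ k; move: (gx k); rewrite e1 e2 e3.
case: tc01 => tc; [left|right]; apply: same => // k kab;
  have [es eo] := ht k kab; rewrite eo; split=> [i|]; rewrite ?es (tk k kab) tc; ring.
Qed.

(** * The exceptional pairs form an algebraic set *)

(** [pair_poly] is homogeneous of degree 9 in the Plücker coordinates of [U], and likewise of [V];
    hence its vanishing survives a change of bases. *)
Lemma general_polyM (S : comNzRingType) (d : nat) (a b c : 'I_d) (A B : 'M[S]_2)
    (U V : 'M[S]_(2, d)) :
  general_poly a b c U V = 0 -> general_poly a b c (A *m U) (B *m V) = 0.
Proof.
move=> UV0; rewrite /general_poly.
rewrite (eq_bigr (fun l => (plucker A 0 1 * plucker B 0 1) ^+ 9 *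
    pair_poly a b c l U V)); last first.
  by move=> l _; rewrite /pair_poly /pslope !pluckerM; ring.
by rewrite big_split /= -/(general_poly a b c U V) UV0 mulr0.
Qed.

Lemma map_general_poly (S T : comNzRingType) (f : {rmorphism S -> T}) (d : nat)
    (a b c : 'I_d) (U V : 'M[S]_(2, d)) :
  f (general_poly a b c U V) = general_poly a b c (map_mx f U) (map_mx f V).
Proof.
have fp (W : 'M[S]_(2, d)) k l : f (plucker W k l) = plucker (map_mx f W) k l.
  by rewrite /plucker rmorphB !rmorphM !mxE.
rewrite /general_poly rmorph_prod; apply: eq_bigr => l _.
by rewrite /pair_poly /pslope /= -!fp !(rmorphM, rmorphB).
Qed.

(** The polynomial is [general_poly] of matrices of indeterminates, as evaluation is a ring
    morphism. *)
Lemma general_poly_algebraic (R : realType) (d : nat) (a b c : 'I_d) :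
  exists f : {mpoly R[(d + 2 * d) + (d + 2 * d)]}, forall p U q V,
    f.@[pair_coords p U q V 0] = general_poly a b c U V.
Proof.
pose X : 'rV[{mpoly R[(d + 2 * d) + (d + 2 * d)]}]_((d + 2 * d) + (d + 2 * d)) :=
  \row_i 'X_i.
exists (general_poly a b c (vec_mx (rsubmx (lsubmx X))) (vec_mx (rsubmx (rsubmx X)))).
move=> p U q V; rewrite map_general_poly !map_vec_mx.
rewrite map_rsubmx map_lsubmx map_rsubmx map_rsubmx.
have -> : map_mx (meval (pair_coords p U q V 0)) X = pair_coords p U q V.
  by apply/rowP => i; rewrite [LHS]mxE [X 0 i]mxE mevalXU.
by rewrite /pair_coords row_mxKl !row_mxKr !mxvecK.
Qed.

(** Each row of [U'] is a difference of two points of the common flat. *)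
Lemma flat_eqP (R : realType) (k d : nat) (p p' : 'rV[R]_d) (U U' : 'M[R]_(k, d)) :
  flat p U = flat p' U' -> exists A, U' = A *m U.
Proof.
move=> e; apply/submxP/row_subP => i.
have h x : (x - p' <= U')%MS -> (x - p <= U)%MS.
  by move=> xU; have : flat p' U' x by []; rewrite -e.
have h1 : (p' - p <= U)%MS by apply: h; rewrite subrr sub0mx.
have h2 : (p' + row i U' - p <= U)%MS by apply: h; rewrite addrC addKr row_sub.
rewrite (_ : row i U' = (p' + row i U' - p) - (p' - p)); last first.
  by rewrite opprB addrA subrK addrC addKr.
by rewrite addmx_sub // eqmx_opp.
Qed.

Definition special_pairs (R : realType) (d : nat) (a b c : 'I_d) :
    set (set 'rV[R]_d * set 'rV[R]_d) :=
  [set FF | exists p U q V, [/\ row_free U, row_free V,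
     FF = (flat p U, flat q V) & general_poly a b c U V = 0]].

Lemma special_pairsE (R : realType) (d : nat) (a b c : 'I_d) p q
    (U V : 'M[R]_(2, d)) : row_free U -> row_free V ->
  special_pairs a b c (flat p U, flat q V) <-> general_poly a b c U V = 0.
Proof.
move=> Uf Vf; split=> [[p' [U' [q' [V' [_ _ [eF eG] g0]]]]]|g0]; last first.
  by exists p, U, q, V.
have [A ->] := flat_eqP (esym eF); have [B ->] := flat_eqP (esym eG).
exact: general_polyM.
Qed.

(** * Properness of the exceptional set, and the conclusion *)

Lemma general_poly_witness (R : numFieldType) (d : nat) (a b c : 'I_d) :
  uniq [:: a; b; c] -> exists U V : 'M[R]_(2, d),
  [/\ row_free U, row_free V & general_poly a b c U V != 0].
Proof.
rewrite /= !inE andbT => /andP[/norP[ab ac] bc].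
pose W (u v : 'I_d -> R) : 'M[R]_(2, d) := \matrix_(i, j)
  (if j == a then (i == 0)%:R else if j == b then (i == 1)%:R else
   if i == 0 then u j else v j).
have Wfree u v : row_free (W u v).
  apply/row_freeP; exists (\matrix_(j, i) (j == if i == 0 then a else b)%:R).
  apply/matrixP => i j; rewrite !mxE (bigD1 (if j == 0 then a else b)) //=.
  rewrite big1 => [|k kj]; last by rewrite !mxE (negPf kj) mulr0.
  rewrite !mxE eqxx mulr1 addr0; case: (j =P 0) => [->|/eqP j0].
    by rewrite eqxx.
  have -> : j = 1 by apply/val_inj; case: j j0 => [[|[|]]].
  by rewrite eq_sym (negPf ab) eqxx.
have Wa u v : W u v 0 a = 1 /\ W u v 1 a = 0 by rewrite !mxE !eqxx.
have Wb u v : W u v 0 b = 0 /\ W u v 1 b = 1.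
  by rewrite !mxE [b == a]eq_sym (negPf ab) !eqxx.
have Wk u v k : k != a -> k != b -> W u v 0 k = u k /\ W u v 1 k = v k.
  by move=> ka kb; rewrite !mxE (negPf ka) (negPf kb).
(* All slopes of [U] off [a], [b] are 1; those of [V] are [(1, 2)] at [c] and [(2, 1)] elsewhere. *)
pose U := W (fun=> 1) (fun=> 1).
pose V := W (fun k => if k == c then 1 else 2) (fun k => if k == c then 2 else 1).
exists U, V; split; [exact: Wfree | exact: Wfree |].
rewrite /general_poly; apply/prodf_neq0 => l; rewrite !inE !negb_or.
move=> /and3P[la lb lc].
have ca : c != a by rewrite eq_sym.
have cb : c != b by rewrite eq_sym.
rewrite /pair_poly /pslope /plucker /U /V.
rewrite !(Wa _ _).1 !(Wa _ _).2 !(Wb _ _).1 !(Wb _ _).2.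
rewrite !(Wk _ _ c ca cb).1 !(Wk _ _ c ca cb).2 !(Wk _ _ l la lb).1 !(Wk _ _ l la lb).2.
rewrite eqxx (negPf lc).
set r := (X in X != 0).
(* The slopes of [V] contribute 4, the determinant -1, and the last factor [4 - 1 = 3]. *)
suff -> : r = - 12 by rewrite oppr_eq0 pnatr_eq0.
by rewrite /r; ring.
Qed.

Lemma frame_hull_two_general (R : realType) (d : nat) : (3 < d)%N ->
  exists Z : set (set 'rV[R]_d * set 'rV[R]_d),
    [/\ algebraic_pairs 2 Z,
        Z `<` flats R 2 d `*` flats R 2 d &
        forall F1 F2 : set 'rV[R]_d,
          flats R 2 d F1 -> flats R 2 d F2 -> ~ Z (F1, F2) ->
          frame_hull 2 [set F1; F2] = [set F1; F2]].
Proof.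
case: d => [|[|[|[|d]]]] // _.
pose a : 'I_d.+4 := inord 0; pose b : 'I_d.+4 := inord 1.
pose c : 'I_d.+4 := inord 2; pose l : 'I_d.+4 := inord 3.
have uabc : uniq [:: a; b; c] by rewrite /= !inE -!val_eqE /= !inordK.
(* A fourth coordinate makes the product [general_poly] nonempty. *)
have labc : l \notin [:: a; b; c] by rewrite /= !inE -!val_eqE /= !inordK.
have Zflats : special_pairs a b c `<=` flats R 2 d.+4 `*` flats R 2 d.+4.
  by move=> _ [p [U [q [V [Uf Vf -> _]]]]]; split; [exists p, U|exists q, V].
exists (special_pairs a b c); split.
- split=> //; have [f ef] := general_poly_algebraic R a b c.
  exists [set f] => p U q V Uf Vf; rewrite special_pairsE // -(ef p U q V).
  by split=> [f0 _ ->|]; last exact.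
- split=> // flatsZ; have [U [V [Uf Vf]]] := general_poly_witness R uabc.
  case/eqP; rewrite -(special_pairsE _ _ _ 0 0 Uf Vf); apply: flatsZ.
  by split; [exists 0, U|exists 0, V].
- move=> _ _ [p [U [Uf ->]]] [q [V [Vf ->]]] /special_pairsE UV0.
  have {}UV0 : general_poly a b c U V != 0 by apply/eqP => ?; apply: UV0.
  apply/seteqP; split=> G; first exact: frame_hull_general labc UV0.
  case=> ->; split.
  + by exists p, U.
  + by move=> B _; apply; left.
  + by exists q, V.
  + by move=> B _; apply; right.
Qed.

Theorem proposition25 (R : realType) (d : nat) (hd : d = 4%N \/ d = 5%N) :
  exists Z : set (set 'rV[R]_d * set 'rV[R]_d),
    [/\ algebraic_pairs 2 Z,
        Z `<` flats R 2 d `*` flats R 2 d &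
        forall F1 F2 : set 'rV[R]_d,
          flats R 2 d F1 -> flats R 2 d F2 -> ~ Z (F1, F2) ->
          frame_hull 2 [set F1; F2] = [set F1; F2]].
Proof. by apply: frame_hull_two_general; case: hd => ->. Qed.
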